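(* Let $\omega\in[0,1]$ and let $A\in\mathbb{C}^{m\times m}$, $B\in\mathbb{C}^{m\times n}$, $C\in\mathbb{C}^{n\times m}$, $D\in\mathbb{C}^{n\times n}$ be such that the equation $XCX-XD-AX+B=0$ is in class $\mathbb{H}^\omega$. Then the sequence $\{\Phi_k\}$ generated by Newton's iteration $$\Phi_0=0,\qquad (A-\Phi_kC)\Phi_{k+1}+\Phi_{k+1}(D-C\Phi_k)=B-\Phi_kC\Phi_k,\quad k\ge 0,$$ converges quadratically to the extremal solution $\Phi$ of the equation.
   Context: For a complex square matrix $M$ and a real $\omega\in[0,1]$, the $\omega$-comparison matrix $M_\omega$ is the real matrix with entries $[M_\omega]_{ii}=\omega\,\mathrm{Re}([M]_{ii})+(1-\omega)\,\mathrm{Im}([M]_{ii})$ and $[M_\omega]_{ij}=-|[M]_{ij}|$ for $i\ne j$. A real square matrix $M$ is a nonsingular M-matrix if all its off-diagonal entries are nonpositive and $Mu>0$ (entrywise) for some vector $u>0$. The equation $XCX-XD-AX+B=0$ (unknown $X\in\mathbb{C}^{m\times n}$) is in class $\mathbb{H}^\omega$ if $Q_\omega$ is a nonsingular M-matrix, where $Q=\begin{pmatrix}D&-C\\-B&A\end{pmatrix}$. The extremal solution $\Phi$ is the unique solution such that every eigenvalue $\lambda$ of $D-C\Phi$ satisfies $\omega\,\mathrm{Re}(\lambda)+(1-\omega)\,\mathrm{Im}(\lambda)>0$. Quadratic convergence has its usual meaning for Newton's method: $\Phi_k\to\Phi$ and there is a constant $K$ with $\|\Phi_{k+1}-\Phi\|\le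 K\|\Phi_k-\Phi\|^2$ for all sufficiently large $k$. *)

(* Defs.v *)
From HB Require Import structures.
From mathcomp Require Import all_boot all_order all_algebra.
From mathcomp Require Import complex.
From mathcomp Require Import all_classical all_reals all_analysis.

Set Implicit Arguments.
Unset Strict Implicit.
Unset Printing Implicit Defensive.

Import Order.TTheory GRing.Theory Num.Theory.
Import numFieldNormedType.Exports.

Local Open Scope ring_scope.
Local Open Scope classical_set_scope.

Definition omega_part (R : realType) (w : R) (z : R[i]) : R :=
  w * complex.Re z + (1 - w) * complex.Im z.

Definition omega_comparison (R : realType) (w : R) (n : nat)
    (M : 'M[R[i]]_n) : 'M[R]_n :=
  \matrix_(i, j)
    if i == j then omega_part w (M i i) else - Normc.normc (M i j).

Definition nonsingular_M_matrix (R : realType) (n : nat) (M : 'M[R]_n) : Prop :=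
  (forall i j, i != j -> M i j <= 0) /\
  exists u : 'cV[R]_n,
    (forall i, 0 < u i 0) /\ (forall i, 0 < (M *m u) i 0).

Section Riccati.
Context (R : realType) (m n : nat).
Context (A : 'M[R[i]]_m) (B : 'M[R[i]]_(m, n)).
Context (C : 'M[R[i]]_(n, m)) (D : 'M[R[i]]_n).

Definition riccati_solution (X : 'M[R[i]]_(m, n)) : Prop :=
  X *m C *m X - X *m D - A *m X + B = 0.

Definition class_H (w : R) : Prop :=
  nonsingular_M_matrix (omega_comparison w (block_mx D (- C) (- B) A)).

Definition extremal_solution (w : R) (Phi : 'M[R[i]]_(m, n)) : Prop :=
  unique (fun X => riccati_solution X /\
    forall l : R[i], eigenvalue (D - C *m X) l -> 0 < omega_part w l) Phi.

Definition newton_step (X Y : 'M[R[i]]_(m, n)) : Prop :=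
  (A - X *m C) *m Y + Y *m (D - C *m X) = B - X *m C *m X.

(* The iteration is implicit, so a sequence is generated by it only if every
   step has a solution and that solution is unique. *)
Definition newton_sequence (Phi : nat -> 'M[R[i]]_(m, n)) : Prop :=
  Phi 0%N = 0 /\ forall k, unique (newton_step (Phi k)) (Phi k.+1).

End Riccati.

(* The norm on matrices is the entrywise maximum norm; any other norm gives the
   same notion.  It takes its values in K, so for K = R[i] the condition
   0 <= c makes the constant c real. *)
Definition converges_quadratically (K : numFieldType) (m n : nat)
    (u : nat -> 'M[K]_(m, n)) (l : 'M[K]_(m, n)) : Prop :=
  u @ \oo --> l /\
  exists2 c : K, 0 <= c &
    \forall k \near \oo, `|u k.+1 - l| <= c * `|u k - l| ^+ 2.

(* Main.v *)
Require Import Defs.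
From mathcomp Require Import all_boot all_order all_algebra.
From mathcomp Require Import complex.
From mathcomp Require Import all_classical all_reals all_analysis.
From mathcomp Require Import ring lra.

Set Implicit Arguments.
Unset Strict Implicit.
Unset Printing Implicit Defensive.

Import Order.TTheory GRing.Theory Num.Theory.
Import numFieldNormedType.Exports.

Local Open Scope ring_scope.

(** The proof compares Newton's iteration with the same iteration for a real
    equation.  Let [a] and [d] be the comparison matrices of [A] and [D], and
    [b], [c] the entrywise moduli of [B] and [C].  The hypothesis provides
    positive vectors [u], [v] with [b u < a v] and [c v < d u].

    A Newton step adds to [X] the solution [H] of the Sylvester equation
    [L_X H = Res X], where [L_X H = (A - X C) H + H (D - C X)] and [Res] is the
    left-hand side of the Riccati equation.  Since [Res] is quadratic, the new
    residual is exactly [H C H] ([residualD]).  Hence, if [S] is the iterate of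
    the real equation with coefficients [a], [b], [c], [d], the inequalities
    [|X| <= S] and [|Res X| <= Res S] pass from one step to the next
    ([majorized_newton]), provided that [L_X^-1] is dominated entrywise by the
    inverse of the real operator at [S].  This domination is
    [sylvester_majorant].  It holds because the modulus of a complex number is
    at least its omega-part, and because a Sylvester operator whose two
    coefficients are M-matrices has a nonnegative inverse ([sylvester_ge0]).

    The real iterates are subsolutions: [S >= 0], [S u <= v], [Res S >= 0].
    For such [S] both [a - S c] and [d - c S] are M-matrices
    ([subsolution_left], [subsolution_right]), and a Newton step yields a
    subsolution again ([subsolution_newton]).  So the real iterates increase and
    stay bounded; they converge, and they force the complex iterates, whose
    increments they dominate, to converge to some [Phi].  The limit of the real
    iterates is again a subsolution.  Its two M-matrices serve all iterates
    and [Phi] at once; they bound [L_X^-1] uniformly along the iteration, which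
    together with the exact expansion of the residual gives the quadratic
    rate.

    The same M-matrices place the spectra of [D - C Phi] and [A - Phi C] in the
    open half-plane where the omega-part is positive.  If [Psi] is another
    solution with this property for [D - C Psi], then
    [(A - Phi C) (Psi - Phi) + (Psi - Phi) (D - C Psi) = 0].  The spectra of
    [A - Phi C] and [- (D - C Psi)] are disjoint, whence [Psi = Phi]
    ([sylvester_spectrum_eq0]). *)

(** * Entrywise order on matrices *)

Definition mx_le (R : numDomainType) (m n : nat) (M N : 'M[R]_(m, n)) : Prop :=
  forall i j, M i j <= N i j.

Definition mx_lt (R : numDomainType) (m n : nat) (M N : 'M[R]_(m, n)) : Prop :=
  forall i j, M i j < N i j.

Notation "M <=m N" := (mx_le M N) (at level 70, no associativity).
Notation "M <m N" := (mx_lt M N) (at level 70, no associativity).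

Lemma addmxE (V : nmodType) (m n : nat) (M N : 'M[V]_(m, n)) i j :
  (M + N) i j = M i j + N i j.
Proof. by rewrite mxE. Qed.

Lemma oppmxE (V : zmodType) (m n : nat) (M : 'M[V]_(m, n)) i j :
  (- M) i j = - M i j.
Proof. by rewrite mxE. Qed.

Lemma scalemxE (K : pzSemiRingType) (m n : nat) (a : K) (M : 'M[K]_(m, n)) i j :
  (a *: M) i j = a * M i j.
Proof. by rewrite mxE. Qed.

Lemma zeromxE (V : nmodType) (m n : nat) i j : (0 : 'M[V]_(m, n)) i j = 0.
Proof. by rewrite mxE. Qed.

Lemma outermxE (K : pzSemiRingType) (m n : nat) (x : 'cV[K]_m) (y : 'rV[K]_n) i j :
  (x *m y) i j = x i 0 * y 0 j.
Proof. by rewrite mxE big_ord1. Qed.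

Ltac mx_expand :=
  rewrite ?(mulmxDl, mulmxDr, mulmxBl, mulmxBr, mulNmx, mulmxN, mulmxA).
Ltac mx_entries := rewrite ?(addmxE, oppmxE, zeromxE).

(** Rectangular matrices do not form a ring.  After distribution the products
    are opaque and the identities needed here are additive, which [ring] checks
    entry by entry. *)
Ltac mx_ring :=
  mx_expand; apply/matrixP => ? ?; mx_entries; ring.

Section MatrixOrder.
Context (R : numDomainType).

Lemma mx_le_trans m n (M N P : 'M[R]_(m, n)) : M <=m N -> N <=m P -> M <=m P.
Proof. by move=> MN NP i j; apply: le_trans (MN i j) (NP i j). Qed.

Lemma mx_lt_le m n (M N : 'M[R]_(m, n)) : M <m N -> M <=m N.
Proof. by move=> MN i j; apply: ltW. Qed.

Lemma mx_le_lt_trans m n (M N P : 'M[R]_(m, n)) : M <=m N -> N <m P -> M <m P.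
Proof. by move=> MN NP i j; apply: le_lt_trans (MN i j) (NP i j). Qed.

Lemma mx_leD m n (M N P Q : 'M[R]_(m, n)) :
  M <=m N -> P <=m Q -> M + P <=m N + Q.
Proof. by move=> MN PQ i j; mx_entries; apply: lerD. Qed.

Lemma mx_subr_ge0 m n (M N : 'M[R]_(m, n)) : 0 <=m N - M <-> M <=m N.
Proof.
by split=> h i j; have := h i j; mx_entries; rewrite subr_ge0.
Qed.

Lemma mx_subr_gt0 m n (M N : 'M[R]_(m, n)) : 0 <m N - M <-> M <m N.
Proof.
by split=> h i j; have := h i j; mx_entries; rewrite subr_gt0.
Qed.

Lemma mx_ge0D m n (M N : 'M[R]_(m, n)) : 0 <=m M -> 0 <=m N -> 0 <=m M + N.
Proof.
by move=> M0 N0 i j; have := M0 i j; have := N0 i j; mx_entries => *; rewrite addr_ge0.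
Qed.

Lemma mx_ge0M m n p (M : 'M[R]_(m, n)) (N : 'M[R]_(n, p)) :
  0 <=m M -> 0 <=m N -> 0 <=m M *m N.
Proof.
move=> M0 N0 i j; rewrite !mxE; apply: sumr_ge0 => k _; apply: mulr_ge0.
  by have := M0 i k; rewrite mxE.
by have := N0 k j; rewrite mxE.
Qed.

Lemma mx_leM2r m n p (P : 'M[R]_(n, p)) (M N : 'M[R]_(m, n)) :
  0 <=m P -> M <=m N -> M *m P <=m N *m P.
Proof.
move=> P0 /mx_subr_ge0 MN; apply/mx_subr_ge0; rewrite -mulmxBl.
exact: mx_ge0M.
Qed.

Lemma mx_leM2l m n p (P : 'M[R]_(m, n)) (M N : 'M[R]_(n, p)) :
  0 <=m P -> M <=m N -> P *m M <=m P *m N.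
Proof.
move=> P0 /mx_subr_ge0 MN; apply/mx_subr_ge0; rewrite -mulmxBr.
exact: mx_ge0M.
Qed.

Lemma mx_leM m n p (M N : 'M[R]_(m, n)) (P Q : 'M[R]_(n, p)) :
  0 <=m M -> 0 <=m Q -> M <=m N -> P <=m Q -> M *m P <=m N *m Q.
Proof.
move=> M0 Q0 MN PQ.
by apply: mx_le_trans (mx_leM2l M0 PQ) _; exact: mx_leM2r.
Qed.

End MatrixOrder.

(** * Sylvester operators *)

Definition sylvester (K : pzRingType) (m n : nat) (M1 : 'M[K]_m) (M2 : 'M[K]_n)
    (X : 'M[K]_(m, n)) : 'M[K]_(m, n) :=
  M1 *m X + X *m M2.

Lemma sylvesterB (K : pzRingType) (m n : nat) (M1 : 'M[K]_m) (M2 : 'M[K]_n)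
    (X Y : 'M[K]_(m, n)) :
  sylvester M1 M2 (X - Y) = sylvester M1 M2 X - sylvester M1 M2 Y.
Proof. by rewrite /sylvester mulmxBr mulmxBl opprD addrACA. Qed.

Lemma sylvester0 (K : pzRingType) (m n : nat) (M1 : 'M[K]_m) (M2 : 'M[K]_n) :
  sylvester M1 M2 0 = 0 :> 'M[K]_(m, n).
Proof. by rewrite /sylvester mulmx0 mul0mx addr0. Qed.

Lemma sylvesterN (K : pzRingType) (m n : nat) (M1 : 'M[K]_m) (M2 : 'M[K]_n)
    (X : 'M[K]_(m, n)) :
  sylvester M1 M2 (- X) = - sylvester M1 M2 X.
Proof. by rewrite -sub0r sylvesterB sylvester0 sub0r. Qed.

Definition sylvester_solve (K : fieldType) (m n : nat)
    (M1 : 'M[K]_m) (M2 : 'M[K]_n) (F : 'M[K]_(m, n)) : 'M[K]_(m, n) :=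
  vec_mx (mxvec F *m invmx (lin_mx (mulmx M1) + lin_mx (mulmxr M2))).

(** An injective endomorphism of a finite-dimensional space is bijective. *)
Lemma sylvester_solveK (K : fieldType) (m n : nat)
    (M1 : 'M[K]_m) (M2 : 'M[K]_n) :
  (forall X : 'M[K]_(m, n), sylvester M1 M2 X = 0 -> X = 0) ->
  forall F : 'M[K]_(m, n), sylvester M1 M2 (sylvester_solve M1 M2 F) = F.
Proof.
move=> inj F.
set L := lin_mx (mulmx M1) + lin_mx (mulmxr M2).
have LE X : mxvec X *m L = mxvec (sylvester M1 M2 X).
  by rewrite mulmxDr !mul_vec_lin /= -raddfD.
have uL : L \in unitmx.
  rewrite -row_free_unit; apply/inj_row_free => v.
  rewrite -[v]vec_mxK LE => /(canRL mxvecK); rewrite linear0 => /inj ->.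
  by rewrite linear0.
by apply: (can_inj mxvecK); rewrite -LE vec_mxK mulmxKV.
Qed.

(** * M-matrices *)

Definition Z_matrix (R : numDomainType) (n : nat) (N : 'M[R]_n) : Prop :=
  forall i j, i != j -> N i j <= 0.

Lemma Z_matrix_mul_le (R : numDomainType) (m n : nat) (N : 'M[R]_m)
    (z w : 'M[R]_(m, n)) (i : 'I_m) (j : 'I_n) :
  Z_matrix N -> (forall k, w k j <= z k j) -> z i j = w i j ->
  (N *m z) i j <= (N *m w) i j.
Proof.
move=> ZN wz zw; rewrite !mxE; apply: ler_sum => k _.
have [<-|ki] := eqVneq i k; first by rewrite zw.
by rewrite ler_wnM2l // ZN.
Qed.

(** A maximum principle: if [Z] has a negative entry, consider the entry where
    [Z i j / (x i * y j)] attains its minimum [t < 0].  There [Z] agrees with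
    [t x y] and lies above it elsewhere; off-diagonal coefficients being
    nonpositive, the image of [Z] is at most that of [t x y], which is
    negative. *)
Lemma sylvester_ge0_weighted (R : realFieldType) (m n : nat)
    (N1 : 'M[R]_m) (N2 : 'M[R]_n) (x : 'cV[R]_m) (y : 'rV[R]_n)
    (Z : 'M[R]_(m, n)) :
  Z_matrix N1 -> Z_matrix N2 -> 0 <m x -> 0 <m y ->
  0 <m N1 *m x -> 0 <=m y *m N2 -> 0 <=m sylvester N1 N2 Z -> 0 <=m Z.
Proof.
move=> ZN1 ZN2 x0 y0 Nx0 yN0 LZ i0 j0; rewrite mxE leNgt; apply/negP => Z0.
have x_gt0 i : 0 < x i 0 by have := x0 i 0; rewrite mxE.
have y_gt0 j : 0 < y 0 j by have := y0 0 j; rewrite mxE.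
pose q (p : 'I_m * 'I_n) := Z p.1 p.2 / (x p.1 0 * y 0 p.2).
case: (@Order.TotalTheory.arg_minP _ _ _ (i0, j0) xpredT q isT) => -[i j] _ qmin.
set t := q (i, j) in qmin.
have t_lt0 : t < 0.
  by apply: le_lt_trans (qmin (i0, j0) isT) _; rewrite /q /= pmulr_llt0 // invr_gt0 mulr_gt0.
pose W : 'M[R]_(m, n) := t *: (x *m y).
have WE k l : W k l = t * (x k 0 * y 0 l) by rewrite scalemxE outermxE.
have WZ k l : W k l <= Z k l.
  by rewrite WE -ler_pdivlMr ?mulr_gt0 // (qmin (k, l)).
have Wij : Z i j = W i j by rewrite WE /t /q /= divfK // gt_eqF // mulr_gt0.
have := LZ i j; rewrite mxE leNgt => /negP; apply.
have le1 : (N1 *m Z) i j <= (N1 *m W) i j by exact: Z_matrix_mul_le.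
have le2 : (Z *m N2) i j <= (W *m N2) i j.
  rewrite ![(_ *m N2) i j]mxE; apply: ler_sum => k _.
  have [->|kj] := eqVneq k j; first by rewrite Wij.
  by rewrite ler_wnM2r // ZN2.
rewrite /sylvester addmxE; apply: le_lt_trans (lerD le1 le2) _.
rewrite /W -scalemxAr -scalemxAl mulmxA -[x *m y *m N2]mulmxA.
rewrite !scalemxE -mulrDr nmulr_rlt0 //.
rewrite !outermxE.
have := Nx0 i 0; have := yN0 0 j; rewrite !zeromxE => yN Nx.
apply: ltr_pwDl; first exact: mulr_gt0.
by rewrite mulr_ge0 // ltW.
Qed.

(** A nonnegative vector that [N] maps to a positive one is already positive,
    because the off-diagonal entries can only lower the product. *)
Lemma Z_matrix_col_gt0 (R : realFieldType) (n : nat) (N : 'M[R]_n)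
    (x : 'cV[R]_n) :
  Z_matrix N -> 0 <=m x -> 0 <m N *m x -> 0 <m x.
Proof.
move=> ZN x0 Nx i j; have := x0 i j; rewrite ord1 {j} zeromxE le_eqVlt.
case/orP => // /eqP xi; have := Nx i 0; rewrite zeromxE mxE (bigD1 i) //= -xi mulr0 add0r.
rewrite ltNge => /negP[]; apply: sumr_le0 => k ki.
have := x0 k 0; rewrite zeromxE => xk.
by rewrite mulr_le0_ge0 // ZN // eq_sym.
Qed.

Lemma Z_matrix_tr (R : numDomainType) (n : nat) (N : 'M[R]_n) :
  Z_matrix N -> Z_matrix N^T.
Proof. by move=> ZN i j ij; rewrite mxE ZN // eq_sym. Qed.

Section MMatrix.
Context (R : realType).

Lemma nonsingular_M_matrixP (n : nat) (N : 'M[R]_n) :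
  nonsingular_M_matrix N <->
  Z_matrix N /\ exists x : 'cV[R]_n, 0 <m x /\ 0 <m N *m x.
Proof.
split=> -[ZN [x [x0 Nx]]]; split=> //; exists x; split.
- by move=> i j; rewrite ord1 zeromxE.
- by move=> i j; rewrite ord1 zeromxE.
- by move=> i; have := x0 i 0; rewrite zeromxE.
- by move=> i; have := Nx i 0; rewrite zeromxE.
Qed.

(** The row sums of [N^-1], which is nonnegative, are turned into column sums:
    [y = (1 ... 1) N^-1] satisfies [y N = (1 ... 1)]. *)
Lemma nonsingular_M_matrix_row (n : nat) (N : 'M[R]_n) :
  nonsingular_M_matrix N -> exists y : 'rV[R]_n, 0 <m y /\ 0 <m y *m N.
Proof.
case/nonsingular_M_matrixP => ZN [x [x0 Nx]].
have Z0 : Z_matrix (0 : 'M[R]_n) by move=> i j; rewrite mxE.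
have one_gt0 k : 0 <m (const_mx 1 : 'rV[R]_k) by move=> i j; rewrite !mxE ltr01.
have monotone (X : 'M[R]_n) : 0 <=m N *m X -> 0 <=m X.
  move=> NX; apply: (sylvester_ge0_weighted ZN Z0 x0 (one_gt0 n) Nx).
    by rewrite mulmx0.
  by rewrite /sylvester mulmx0 addr0.
have inj (X : 'M[R]_n) : sylvester N 0 X = 0 -> X = 0.
  rewrite /sylvester mulmx0 addr0 => NX; apply/matrixP => i j.
  rewrite zeromxE; apply/eqP; rewrite eq_le.
  have := monotone (- X); rewrite mulmxN NX oppr0 => /(_ (fun _ _ => lexx _) i j).
  have := monotone X; rewrite NX => /(_ (fun _ _ => lexx _) i j).
  by rewrite zeromxE oppmxE oppr_ge0 => -> ->.
have := sylvester_solveK inj 1%:M; set X := sylvester_solve _ _ _.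
rewrite /sylvester mulmx0 addr0 => NX1.
have X0 : 0 <=m X.
  by apply: monotone; rewrite NX1 => i j; rewrite !mxE ler0n.
pose y : 'rV[R]_n := const_mx 1 *m X.
have yN : y *m N = const_mx 1 by rewrite -mulmxA (mulmx1C NX1) mulmx1.
exists y; rewrite yN; split; last exact: one_gt0.
have y0 : 0 <=m y^T.
  move=> i j; have := @mx_ge0M _ _ _ _ (const_mx 1) X (mx_lt_le (one_gt0 n)) X0 j i.
  by rewrite !zeromxE [y^T i j]mxE.
have yN0 : 0 <m N^T *m y^T.
  by rewrite -trmx_mul yN => i j; rewrite !mxE ltr01.
have := Z_matrix_col_gt0 (Z_matrix_tr ZN) y0 yN0 => y_gt0 i j.
by have := y_gt0 j i; rewrite !mxE.
Qed.

Lemma sylvester_ge0 (m n : nat) (N1 : 'M[R]_m) (N2 : 'M[R]_n) (Z : 'M[R]_(m, n)) :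
  nonsingular_M_matrix N1 -> nonsingular_M_matrix N2 ->
  0 <=m sylvester N1 N2 Z -> 0 <=m Z.
Proof.
move=> M1 M2; have [y [y0 yN]] := nonsingular_M_matrix_row M2.
case/nonsingular_M_matrixP: M1 => ZN1 [x [x0 Nx]].
case/nonsingular_M_matrixP: M2 => ZN2 _.
exact: (sylvester_ge0_weighted ZN1 ZN2 x0 y0 Nx (mx_lt_le yN)).
Qed.

Lemma sylvester_M_matrix_inj (m n : nat) (N1 : 'M[R]_m) (N2 : 'M[R]_n) :
  nonsingular_M_matrix N1 -> nonsingular_M_matrix N2 ->
  forall Y : 'M[R]_(m, n), sylvester N1 N2 Y = 0 -> Y = 0.
Proof.
move=> M1 M2 Y LY; apply/matrixP => i j; rewrite zeromxE; apply/eqP; rewrite eq_le.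
have := @sylvester_ge0 _ _ _ _ Y M1 M2; rewrite LY => /(_ (fun _ _ => lexx _) i j).
have := @sylvester_ge0 _ _ _ _ (- Y) M1 M2.
rewrite sylvesterN LY oppr0 => /(_ (fun _ _ => lexx _) i j).
by rewrite zeromxE oppmxE oppr_ge0 => -> ->.
Qed.

Lemma mulmx_M_matrix_ge0 (m : nat) (N : 'M[R]_m) (z : 'cV[R]_m) :
  nonsingular_M_matrix N -> 0 <=m N *m z -> 0 <=m z.
Proof.
case/nonsingular_M_matrixP => ZN [x [x0 Nx]] Nz.
apply: (@sylvester_ge0_weighted _ _ _ N 0 x (const_mx 1)) => //.
- by move=> i j; rewrite mxE.
- by move=> i j; rewrite !mxE.
- by rewrite mulmx0.
- by rewrite /sylvester mulmx0 addr0.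
Qed.

End MMatrix.

(** * The Riccati residual *)

Definition residual (K : pzRingType) (m n : nat) (A : 'M[K]_m)
    (B : 'M[K]_(m, n)) (C : 'M[K]_(n, m)) (D : 'M[K]_n) (X : 'M[K]_(m, n)) :=
  X *m C *m X - X *m D - A *m X + B.

Lemma residualD (K : comPzRingType) (m n : nat) (A : 'M[K]_m)
    (B : 'M[K]_(m, n)) (C : 'M[K]_(n, m)) (D : 'M[K]_n) (X H : 'M[K]_(m, n)) :
  residual A B C D (X + H) =
  residual A B C D X - sylvester (A - X *m C) (D - C *m X) H + H *m C *m H.
Proof. by rewrite /residual /sylvester; mx_ring. Qed.

Lemma residualB (K : comPzRingType) (m n : nat) (A : 'M[K]_m)
    (B : 'M[K]_(m, n)) (C : 'M[K]_(n, m)) (D : 'M[K]_n) (X Y : 'M[K]_(m, n)) :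
  sylvester (A - X *m C) (D - C *m Y) (Y - X) =
  residual A B C D X - residual A B C D Y.
Proof. by rewrite /residual /sylvester; mx_ring. Qed.

Lemma newton_stepE (R : realType) (m n : nat) (A : 'M[R[i]]_m)
    (B : 'M[R[i]]_(m, n)) (C : 'M[R[i]]_(n, m)) (D : 'M[R[i]]_n)
    (X Y : 'M[R[i]]_(m, n)) :
  newton_step A B C D X Y <->
  sylvester (A - X *m C) (D - C *m X) (Y - X) = residual A B C D X.
Proof.
rewrite /newton_step.
have -> : sylvester (A - X *m C) (D - C *m X) (Y - X) =
  ((A - X *m C) *m Y + Y *m (D - C *m X) - (B - X *m C *m X))
    + residual A B C D X.
  by rewrite /residual /sylvester; mx_ring.
split=> [->|]; first by rewrite subrr add0r.
by move/(canRL (addrK _)); rewrite subrr => /eqP; rewrite subr_eq0 => /eqP.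
Qed.

(** * The real majorant equation *)

Section Majorant.
Context (R : realType) (m n : nat).
Context (a : 'M[R]_m) (b : 'M[R]_(m, n)) (c : 'M[R]_(n, m)) (d : 'M[R]_n).
Context (u : 'cV[R]_n) (v : 'cV[R]_m).

(** For the comparison matrix of the Riccati coefficients, this is the
    M-matrix property with the positive vector split into blocks. *)
Definition dominant_data : Prop :=
  [/\ Z_matrix a, Z_matrix d, 0 <=m b & 0 <=m c] /\
  [/\ 0 <m u, 0 <m v, b *m u <m a *m v & c *m v <m d *m u].

Definition subsolution (S : 'M[R]_(m, n)) : Prop :=
  [/\ 0 <=m S, S *m u <=m v & 0 <=m residual a b c d S].

Hypothesis dom : dominant_data.

Lemma subsolution0 : subsolution 0.
Proof.
case: dom => -[_ _ b0 _] [_ v0 _ _]; split=> //; rewrite ?mul0mx; first exact: mx_lt_le.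
by rewrite /residual !mul0mx mulmx0 !subr0 add0r.
Qed.

Lemma Z_matrixB (k : nat) (N P : 'M[R]_k) :
  Z_matrix N -> 0 <=m P -> Z_matrix (N - P).
Proof.
move=> ZN P0 i j ij; mx_entries; rewrite subr_le0.
by apply: le_trans (ZN i j ij) _; have := P0 i j; rewrite zeromxE.
Qed.

Lemma subsolution_right S : subsolution S -> nonsingular_M_matrix (d - c *m S).
Proof.
case: dom => -[_ Zd _ c0] [u0 _ _ cd] [S0 Su _].
apply/nonsingular_M_matrixP; split; first exact/Z_matrixB/mx_ge0M.
exists u; split=> //; rewrite mulmxBl -mulmxA; apply/mx_subr_gt0.
exact: mx_le_lt_trans (mx_leM2l c0 Su) cd.
Qed.

Lemma subsolution_gap S : subsolution S ->
  0 <m (a *m v - b *m u) + S *m (d *m u - c *m v).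
Proof.
case: dom => _ [_ _ ab cd] [S0 _ _] i j; mx_entries.
apply: ltr_pwDl; first by rewrite subr_gt0; apply: ab.
have := mx_ge0M S0 (mx_lt_le (proj2 (mx_subr_gt0 _ _) cd)).
by move=> /(_ i j); mx_entries.
Qed.

(** The slack [v - S u] is the weight vector that makes [a - S c] an
    M-matrix: the residual inequality trades the term [S c S u] for
    [S d u], and [d u] dominates [c v]. *)
Lemma subsolution_left S : subsolution S -> nonsingular_M_matrix (a - S *m c).
Proof.
move=> subS; have gap := subsolution_gap subS.
case: dom subS => -[Za _ _ c0] [u0 _ _ _] [S0 Su resS].
have ZaS : Z_matrix (a - S *m c) by apply: Z_matrixB => //; exact: mx_ge0M.
have slack : 0 <m (a - S *m c) *m (v - S *m u).
  have -> : (a - S *m c) *m (v - S *m u) =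
    ((a *m v - b *m u) + S *m (d *m u - c *m v)) + residual a b c d S *m u.
    by rewrite /residual; mx_ring.
  move=> i j; have := mx_ge0M resS (mx_lt_le u0) i j; have := gap i j.
  by mx_entries => g r; apply: ltr_pwDl.
apply/nonsingular_M_matrixP; split=> //; exists (v - S *m u); split=> //.
by apply: Z_matrix_col_gt0 ZaS _ slack; apply/mx_subr_ge0.
Qed.

(** The M-matrix [a - S c] maps [v - (S + G) u] to a sum of nonnegative terms,
    and M-matrices have nonnegative inverses; this gives the bound on
    [(S + G) u].  The new residual is [G c G]. *)
Lemma subsolution_newton S G : subsolution S ->
  sylvester (a - S *m c) (d - c *m S) G = residual a b c d S ->
  0 <=m G /\ subsolution (S + G).
Proof.
move=> subS LG; have gap := subsolution_gap subS.
have ML := subsolution_left subS; have MR := subsolution_right subS.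
case: dom subS => -[_ _ _ c0] [u0 _ _ cd] [S0 Su resS].
have G0 : 0 <=m G by apply: (sylvester_ge0 ML MR); rewrite LG.
split=> //; split; first exact: mx_ge0D.
  apply/mx_subr_ge0; apply: (mulmx_M_matrix_ge0 ML).
  have -> : (a - S *m c) *m (v - (S + G) *m u) =
    ((a *m v - b *m u) + S *m (d *m u - c *m v)) + G *m ((d - c *m S) *m u)
     - (sylvester (a - S *m c) (d - c *m S) G - residual a b c d S) *m u.
    by rewrite /residual /sylvester; mx_ring.
  rewrite LG subrr mul0mx subr0.
  apply: mx_ge0D; first exact: mx_lt_le.
  apply: mx_ge0M => //; rewrite mulmxBl -mulmxA; apply/mx_subr_ge0.
  by apply: mx_le_trans (mx_leM2l c0 Su) _; exact: mx_lt_le.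
rewrite residualD LG subrr add0r.
by do 2 apply: mx_ge0M => //.
Qed.

End Majorant.

(** * Comparison of complex and real matrices *)

Notation normc := Normc.normc.

Definition mxabs (R : realType) (m n : nat) (M : 'M[R[i]]_(m, n)) : 'M[R]_(m, n) :=
  \matrix_(i, j) normc (M i j).

Section Comparison.
Context (R : realType).
Implicit Types z t : R[i].

Lemma normrE z : `|z| = (normc z)%:C%C.
Proof. by []. Qed.

Lemma normc_triangle z t : normc (z + t) <= normc z + normc t.
Proof. by rewrite -lecR rmorphD /= -!normrE ler_normD. Qed.

Lemma normc_opp z : normc (- z) = normc z.
Proof. by apply: complexI; rewrite -!normrE normrN. Qed.

Lemma normc_ge0 z : 0 <= normc z.
Proof. by rewrite -lecR -normrE normr_ge0. Qed.

Lemma normc_eq0 z : normc z = 0 -> z = 0.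
Proof. exact: Normc.eq0_normc. Qed.

Lemma normc_sum (I : Type) (r : seq I) (P : pred I) (F : I -> R[i]) :
  normc (\sum_(k <- r | P k) F k) <= \sum_(k <- r | P k) normc (F k).
Proof. by rewrite -lecR rmorph_sum /= -normrE; exact: ler_norm_sum. Qed.

Lemma Re_le_normc z : `|complex.Re z| <= normc z.
Proof. by rewrite -lecR; exact: normc_ge_Re. Qed.

Lemma Im_le_normc z : `|complex.Im z| <= normc z.
Proof.
by case: z => x y; rewrite /= -sqrtr_sqr ler_wsqrtr // lerDr sqr_ge0.
Qed.

Lemma omega_partD w z t : omega_part w (z + t) = omega_part w z + omega_part w t.
Proof. by rewrite /omega_part !raddfD /=; ring. Qed.

Lemma omega_partN w z : omega_part w (- z) = - omega_part w z.
Proof. by rewrite /omega_part !raddfN /=; ring. Qed.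

Lemma omega_part_le_normc w z : 0 <= w <= 1 -> omega_part w z <= normc z.
Proof.
case/andP => w0 w1; have := Re_le_normc z; have := Im_le_normc z.
move=> /(le_trans (ler_norm _)) Iz /(le_trans (ler_norm _)) Rz.
rewrite /omega_part; nra.
Qed.

Lemma mxabs_ge0 m n (M : 'M[R[i]]_(m, n)) : 0 <=m mxabs M.
Proof. by move=> i j; rewrite !mxE normc_ge0. Qed.

Lemma mxabsN m n (M : 'M[R[i]]_(m, n)) : mxabs (- M) = mxabs M.
Proof. by apply/matrixP => i j; rewrite !mxE normc_opp. Qed.

Lemma mxabs0 m n : mxabs (0 : 'M[R[i]]_(m, n)) = 0.
Proof. by apply/matrixP => i j; rewrite !mxE Normc.normc0. Qed.

Lemma mxabs_eq0 m n (M : 'M[R[i]]_(m, n)) : mxabs M <=m 0 -> M = 0.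
Proof.
move=> M0; apply/matrixP => i j; rewrite zeromxE; apply: normc_eq0.
by apply/eqP; rewrite eq_le normc_ge0 andbT; have := M0 i j; rewrite !mxE.
Qed.

Lemma mxabsD m n (M N : 'M[R[i]]_(m, n)) : mxabs (M + N) <=m mxabs M + mxabs N.
Proof. by move=> i j; rewrite !mxE normc_triangle. Qed.

Lemma mxabsM m n p (M : 'M[R[i]]_(m, n)) (N : 'M[R[i]]_(n, p)) :
  mxabs (M *m N) <=m mxabs M *m mxabs N.
Proof.
move=> i j; rewrite !mxE; apply: le_trans (normc_sum _ _ _) _.
by apply: ler_sum => k _; rewrite !mxE Normc.normcM.
Qed.

Context (w : R).
Hypothesis w01 : 0 <= w <= 1.

Lemma Z_matrix_omega_comparison n (M : 'M[R[i]]_n) :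
  Z_matrix (omega_comparison w M).
Proof. by move=> i j /negbTE ij; rewrite mxE ij oppr_le0 normc_ge0. Qed.

Lemma omega_comparisonB n (M E : 'M[R[i]]_n) :
  omega_comparison w M - mxabs E <=m omega_comparison w (M - E).
Proof.
move=> i j; mx_entries; rewrite !mxE; case: eqVneq => [<-|_].
  by rewrite omega_partD omega_partN lerB // omega_part_le_normc.
by rewrite -opprD lerN2; apply: le_trans (normc_triangle _ _) _; rewrite normc_opp.
Qed.

(** In entry [i, j] of [M1 Y + Y M2] the unknown [Y i j] has the coefficient
    [M1 i i + M2 j j], whose modulus is at least its omega-part; all the other
    terms are bounded by the triangle inequality. *)
Lemma sylvester_comparison m n (M1 : 'M[R[i]]_m) (M2 : 'M[R[i]]_n)
    (Y : 'M[R[i]]_(m, n)) :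
  sylvester (omega_comparison w M1) (omega_comparison w M2) (mxabs Y)
    <=m mxabs (sylvester M1 M2 Y).
Proof.
move=> i j; rewrite /sylvester [mxabs (_ + _) i j]mxE !addmxE !mxE.
rewrite (bigD1 i) //= (bigD1 j) //= [X in normc (X + _)](bigD1 i) //=.
rewrite [X in normc (_ + X)](bigD1 j) //= !mxE !eqxx.
set s1 := (X in normc (_ + X + _)); set s2 := (X in normc (_ + (_ + X))).
set r1 := \sum_(_ | _) _; set r2 := (X in _ + (_ + X) <= _).
have r1s : r1 <= - normc s1.
  rewrite lerNr; apply: le_trans (normc_sum _ _ _) _; rewrite -sumrN.
  by apply: ler_sum => k /negbTE ki; rewrite !mxE eq_sym ki mulNr opprK Normc.normcM.
have r2s : r2 <= - normc s2.
  rewrite lerNr; apply: le_trans (normc_sum _ _ _) _; rewrite -sumrN.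
  by apply: ler_sum => k /negbTE ki; rewrite !mxE ki mulrN opprK Normc.normcM.
set z := M1 i i; set t := M2 j j; set y := Y i j.
have main : (omega_part w z + omega_part w t) * normc y <= normc (z * y + y * t).
  rewrite [y * t]mulrC -mulrDl Normc.normcM -omega_partD.
  by rewrite ler_wpM2r ?normc_ge0 // omega_part_le_normc.
have tri : normc (z * y + y * t) <=
    normc (z * y + s1 + (y * t + s2)) + normc s1 + normc s2.
  have -> : z * y + y * t = (z * y + s1 + (y * t + s2)) + (- s1) + (- s2) by ring.
  apply: le_trans (normc_triangle _ _) _; rewrite normc_opp lerD2r.
  by apply: le_trans (normc_triangle _ _) _; rewrite normc_opp.
lra.
Qed.

(** Domination of inverses: the real operator maps [Z - |Y|] to something
    nonnegative by [sylvester_comparison], and its inverse is nonnegative. *)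
Lemma sylvester_majorant m n (N1 : 'M[R]_m) (N2 : 'M[R]_n) (M1 : 'M[R[i]]_m)
    (M2 : 'M[R[i]]_n) (Y : 'M[R[i]]_(m, n)) (Z : 'M[R]_(m, n)) :
  nonsingular_M_matrix N1 -> nonsingular_M_matrix N2 ->
  N1 <=m omega_comparison w M1 -> N2 <=m omega_comparison w M2 ->
  mxabs (sylvester M1 M2 Y) <=m sylvester N1 N2 Z -> mxabs Y <=m Z.
Proof.
move=> MN1 MN2 le1 le2 leZ; apply/mx_subr_ge0.
apply: (sylvester_ge0 MN1 MN2).
rewrite sylvesterB; apply/mx_subr_ge0; apply: mx_le_trans leZ.
apply: mx_le_trans (sylvester_comparison M1 M2 Y).
by apply: mx_leD; [apply: mx_leM2r|apply: mx_leM2l] => //; exact: mxabs_ge0.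
Qed.

Lemma sylvester_inj m n (N1 : 'M[R]_m) (N2 : 'M[R]_n) (M1 : 'M[R[i]]_m)
    (M2 : 'M[R[i]]_n) :
  nonsingular_M_matrix N1 -> nonsingular_M_matrix N2 ->
  N1 <=m omega_comparison w M1 -> N2 <=m omega_comparison w M2 ->
  forall Y : 'M[R[i]]_(m, n), sylvester M1 M2 Y = 0 -> Y = 0.
Proof.
move=> MN1 MN2 le1 le2 Y LY; apply: mxabs_eq0.
apply: (sylvester_majorant MN1 MN2 le1 le2).
by rewrite LY mxabs0 sylvester0 => i j.
Qed.

(** The equation [M E = mu E] is the Sylvester equation [M E + E (- mu) = 0],
    and the comparison matrix of [- mu] is the scalar [- omega_part w mu]; when
    that is nonnegative, the maximum principle applies with constant weights on
    the right. *)
Lemma M_matrix_eigen_eq0 n p (N : 'M[R]_n) (M : 'M[R[i]]_n) (mu : R[i])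
    (E : 'M[R[i]]_(n, p)) :
  nonsingular_M_matrix N -> N <=m omega_comparison w M ->
  M *m E = mu *: E -> omega_part w mu <= 0 -> E = 0.
Proof.
case/nonsingular_M_matrixP => ZN [x [x0 Nx]] leN ME mu0.
apply: mxabs_eq0; apply/mx_subr_ge0; rewrite sub0r.
pose N2 : 'M[R]_p := (- omega_part w mu)%:M.
apply: (@sylvester_ge0_weighted _ _ _ N N2 x (const_mx 1)) => //.
- by move=> i j /negbTE ij; rewrite !mxE ij mulr0n.
- by move=> i j; rewrite !mxE ltr01.
- by rewrite mul_mx_scalar => i j; rewrite !mxE mulr1 oppr_ge0.
have LE : sylvester M (- mu)%:M E = 0.
  by rewrite /sylvester mul_mx_scalar ME scaleNr subrr.
have := sylvester_comparison M (- mu)%:M E.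
have -> : omega_comparison w (- mu)%:M = N2.
  apply/matrixP => i j; have [<-|/negbTE ij] := eqVneq i j.
    by rewrite !mxE eqxx !mulr1n omega_partN.
  by rewrite !mxE ij !mulr0n Normc.normc0 oppr0.
rewrite LE mxabs0 => cmp.
rewrite sylvesterN -sub0r; apply/mx_subr_ge0; apply: mx_le_trans cmp.
by apply: mx_leD => //; apply: mx_leM2r => //; exact: mxabs_ge0.
Qed.

End Comparison.

(** * Spectral criteria *)

Lemma char_poly_tr (K : comNzRingType) (n : nat) (M : 'M[K]_n) :
  char_poly M^T = char_poly M.
Proof.
by rewrite /char_poly -det_tr /char_poly_mx linearB /= tr_scalar_mx map_trmx trmxK.
Qed.

Lemma M_matrix_eigenvalue (R : realType) (w : R) (n : nat) (N : 'M[R]_n)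
    (M : 'M[R[i]]_n) :
  0 <= w <= 1 -> nonsingular_M_matrix N -> N <=m omega_comparison w M ->
  forall mu, eigenvalue M mu -> 0 < omega_part w mu.
Proof.
move=> w01 MN leN mu; rewrite eigenvalue_root_char -char_poly_tr -eigenvalue_root_char.
case/eigenvalueP => v vM v0; rewrite ltNge; apply/negP => mu0.
have ME : M *m v^T = mu *: v^T by rewrite -[M]trmxK -trmx_mul vM linearZ.
move/eqP: v0; apply; rewrite -[v]trmxK.
by rewrite (M_matrix_eigen_eq0 w01 MN leN ME mu0) trmx0.
Qed.

(** By the Cayley-Hamilton theorem a product of factors [M2 - z], with [z] an
    eigenvalue of [M2], kills [E]; the factors are removed one at a time.
    When [E (M2 - z) = 0] the columns of [E] are eigenvectors of [M1] for
    the eigenvalue [- z], which an M-matrix below the comparison matrix of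
    [M1] excludes. *)
Lemma sylvester_spectrum_eq0 (R : realType) (w : R) (m n : nat) (N : 'M[R]_m)
    (M1 : 'M[R[i]]_m) (M2 : 'M[R[i]]_n) (E : 'M[R[i]]_(m, n)) :
  0 <= w <= 1 -> nonsingular_M_matrix N -> N <=m omega_comparison w M1 ->
  (forall z, eigenvalue M2 z -> 0 < omega_part w z) ->
  sylvester M1 M2 E = 0 -> E = 0.
Proof.
case: n M2 E => [|n] M2 E w01 MN leN spec; first by rewrite [E]thinmx0.
have [r pE] := closed_field_poly_normal (char_poly M2).
have lead1 : lead_coef (char_poly M2) = 1 by apply/monicP/char_poly_monic.
rewrite lead1 scale1r in pE.
have r_gt0 z : z \in r -> 0 < omega_part w z.
  by move=> zr; apply: spec; rewrite eigenvalue_root_char pE root_prod_XsubC.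
have : E *m \prod_(z <- r) (M2 - z%:M) = 0.
  have -> : \prod_(z <- r) (M2 - z%:M) = horner_mx M2 (char_poly M2).
    rewrite pE rmorph_prod /=; apply: eq_bigr => z _.
    by rewrite rmorphB /= horner_mx_X horner_mx_C.
  by rewrite Cayley_Hamilton mulmx0.
(* [E] varies in the induction, as each factor removed changes it. *)
elim: r E r_gt0 {pE} => [|z r IH] E r_gt0 kill LE.
  by move: kill; rewrite big_nil mulmx1.
have EM : E *m (M2 - z%:M) = 0.
  apply: IH => [t tr||].
  - by apply: r_gt0; rewrite inE tr orbT.
  - by move: kill; rewrite big_cons -mulmxE mulmxA.
  have -> : sylvester M1 M2 (E *m (M2 - z%:M)) =
      sylvester M1 M2 E *m (M2 - z%:M).
    rewrite /sylvester mulmxDl !mulmxBr !mulmxBl !mul_mx_scalar !mulmxA.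
    by rewrite -!scalemxAr -!scalemxAl.
  by rewrite LE mul0mx.
have ME : M1 *m E = (- z) *: E.
  move: LE; rewrite /sylvester => /(canRL (addrK _)) ->; rewrite sub0r.
  move: EM; rewrite mulmxBr mul_mx_scalar => /eqP; rewrite subr_eq0 => /eqP ->.
  by rewrite scaleNr.
apply: (M_matrix_eigen_eq0 w01 MN leN ME).
by rewrite omega_partN oppr_le0 ltW // r_gt0 // inE eqxx.
Qed.

(** * Newton's method below its majorant *)

Definition newton (K : fieldType) (m n : nat) (A : 'M[K]_m) (B : 'M[K]_(m, n))
    (C : 'M[K]_(n, m)) (D : 'M[K]_n) (X : 'M[K]_(m, n)) : 'M[K]_(m, n) :=
  X + sylvester_solve (A - X *m C) (D - C *m X) (residual A B C D X).

Lemma newton_subr (K : fieldType) (m n : nat) (A : 'M[K]_m) (B : 'M[K]_(m, n))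
    (C : 'M[K]_(n, m)) (D : 'M[K]_n) (X : 'M[K]_(m, n)) :
  newton A B C D X - X =
  sylvester_solve (A - X *m C) (D - C *m X) (residual A B C D X).
Proof. by rewrite /newton addrAC subrr add0r. Qed.

Section MajorizedNewton.
Context (R : realType) (m n : nat) (w : R).
Context (A : 'M[R[i]]_m) (B : 'M[R[i]]_(m, n)).
Context (C : 'M[R[i]]_(n, m)) (D : 'M[R[i]]_n).
Context (u : 'cV[R]_n) (v : 'cV[R]_m).

Local Notation a := (omega_comparison w A).
Local Notation b := (mxabs B).
Local Notation c := (mxabs C).
Local Notation d := (omega_comparison w D).

Hypothesis w01 : 0 <= w <= 1.
Hypothesis dom : dominant_data a b c d u v.

Lemma majorant_left X S :
  mxabs X <=m S -> a - S *m c <=m omega_comparison w (A - X *m C).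
Proof.
move=> XS; apply: mx_le_trans (omega_comparisonB w01 _ _).
move=> i j; mx_entries; rewrite lerD2l lerN2.
by apply: le_trans (mxabsM X C i j) _; apply: mx_leM2r (mxabs_ge0 C) XS i j.
Qed.

Lemma majorant_right X S :
  mxabs X <=m S -> d - c *m S <=m omega_comparison w (D - C *m X).
Proof.
move=> XS; apply: mx_le_trans (omega_comparisonB w01 _ _).
move=> i j; mx_entries; rewrite lerD2l lerN2.
by apply: le_trans (mxabsM C X i j) _; apply: mx_leM2l (mxabs_ge0 C) XS i j.
Qed.

(** The bound on the residuals is what makes the relation inductive: it
    compares the next two increments. *)
Definition majorized (X : 'M[R[i]]_(m, n)) (S : 'M[R]_(m, n)) : Prop :=
  [/\ subsolution a b c d u v S, mxabs X <=m S &
      mxabs (residual A B C D X) <=m residual a b c d S].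

Lemma majorized0 : majorized 0 0.
Proof.
split; first exact: subsolution0; first by rewrite mxabs0.
by rewrite /residual !mul0mx !mulmx0 !subr0 !add0r.
Qed.

Lemma majorized_sylvester_inj X S :
  subsolution a b c d u v S -> mxabs X <=m S ->
  forall Y, sylvester (A - X *m C) (D - C *m X) Y = 0 -> Y = 0.
Proof.
move=> subS XS.
exact: (sylvester_inj w01 (subsolution_left dom subS)
  (subsolution_right dom subS) (majorant_left XS) (majorant_right XS)).
Qed.

Lemma newton_unique X S : subsolution a b c d u v S -> mxabs X <=m S ->
  unique (newton_step A B C D X) (newton A B C D X).
Proof.
move=> subS XS; have inj := majorized_sylvester_inj subS XS.
split=> [|Y /newton_stepE YE].
  by apply/newton_stepE; rewrite newton_subr sylvester_solveK.
apply/eqP; rewrite -subr_eq0; apply/eqP/inj.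
have -> : newton A B C D X - Y = (newton A B C D X - X) - (Y - X).
  by rewrite opprB addrA subrK.
by rewrite sylvesterB YE newton_subr sylvester_solveK // subrr.
Qed.

(** Newton increments [H] and [G] satisfy [|H| <= G] because the residuals
    do, and the new residuals are [H C H] and [G c G]. *)
Lemma majorized_newton X S : majorized X S ->
  mxabs (newton A B C D X - X) <=m newton a b c d S - S /\
  majorized (newton A B C D X) (newton a b c d S).
Proof.
case=> subS XS resXS.
have ML := subsolution_left dom subS; have MR := subsolution_right dom subS.
have inj := majorized_sylvester_inj subS XS.
have injR := @sylvester_M_matrix_inj _ _ _ _ _ ML MR.
rewrite !newton_subr /newton; set H := sylvester_solve _ _ _; set G := sylvester_solve _ _ _.
have LH : sylvester (A - X *m C) (D - C *m X) H = residual A B C D X.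
  exact: sylvester_solveK.
have LG : sylvester (a - S *m c) (d - c *m S) G = residual a b c d S.
  exact: sylvester_solveK.
have [G0 subSG] := subsolution_newton dom subS LG.
have HG : mxabs H <=m G.
  apply: (sylvester_majorant w01 ML MR (majorant_left XS) (majorant_right XS)).
  by rewrite LH LG.
split; first exact: HG.
split; [exact: subSG|exact: mx_le_trans (mxabsD X H) (mx_leD XS HG)|].
rewrite !residualD LH LG !subrr !add0r.
apply: mx_le_trans (mxabsM _ _) _.
apply: mx_leM => //; first exact: mxabs_ge0.
exact: mx_le_trans (mxabsM _ _) (mx_leM2r (mxabs_ge0 C) HG).
Qed.

Definition newton_iter k := iter k (newton A B C D) 0.
Definition majorant_iter k := iter k (newton a b c d) 0.

Lemma majorized_iter k : majorized (newton_iter k) (majorant_iter k).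
Proof.
elim: k => [|k IH]; first exact: majorized0.
by have [] := majorized_newton IH.
Qed.

Lemma newton_iter_increment k :
  mxabs (newton_iter k.+1 - newton_iter k) <=m
  majorant_iter k.+1 - majorant_iter k.
Proof. by have [] := majorized_newton (majorized_iter k). Qed.

End MajorizedNewton.

(** * Sequences with a convergent majorant *)

Local Open Scope classical_set_scope.

Definition cvg_entries (K : numFieldType) (m n : nat)
    (x : nat -> 'M[K]_(m, n)) (l : 'M[K]_(m, n)) : Prop :=
  forall i j, (fun k => x k i j) @ \oo --> l i j.

Section CvgEntries.
Context (K : numFieldType).

Lemma cvg_entries_cst m n (M : 'M[K]_(m, n)) : cvg_entries (fun=> M) M.
Proof. by move=> i j; exact: cvg_cst. Qed.

Lemma cvg_entriesD m n (x y : nat -> 'M[K]_(m, n)) l t :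
  cvg_entries x l -> cvg_entries y t -> cvg_entries (fun k => x k + y k) (l + t).
Proof.
move=> xl yt i j; rewrite addmxE; under eq_fun do rewrite addmxE.
by apply: cvgD; [exact: xl|exact: yt].
Qed.

Lemma cvg_entriesB m n (x y : nat -> 'M[K]_(m, n)) l t :
  cvg_entries x l -> cvg_entries y t -> cvg_entries (fun k => x k - y k) (l - t).
Proof.
move=> xl yt i j; mx_entries; under eq_fun do rewrite addmxE oppmxE.
by apply: cvgB; [exact: xl|exact: yt].
Qed.

Lemma cvg_entriesM m n p (x : nat -> 'M[K]_(m, n)) (y : nat -> 'M[K]_(n, p)) l t :
  cvg_entries x l -> cvg_entries y t ->
  cvg_entries (fun k => x k *m y k) (l *m t).
Proof.
move=> xl yt i j; rewrite mxE; under eq_fun do rewrite mxE.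
by apply: cvg_big => [|q _]; [exact: add_continuous|apply: cvgM].
Qed.

Lemma cvg_entries_shift m n (x : nat -> 'M[K]_(m, n)) l :
  cvg_entries x l -> cvg_entries (fun k => x k.+1) l.
Proof. by move=> xl i j; have := xl i j; rewrite -cvg_shiftS. Qed.

Lemma cvg_entries_unique m n (x : nat -> 'M[K]_(m, n)) l t :
  cvg_entries x l -> cvg_entries x t -> l = t.
Proof.
move=> xl xt; apply/matrixP => i j.
by apply: (cvg_unique (@norm_hausdorff _ _) (xl i j) (xt i j)).
Qed.

Lemma cvg_entries_residual m n (A : 'M[K]_m) (B : 'M[K]_(m, n))
    (C : 'M[K]_(n, m)) (D : 'M[K]_n) (x : nat -> 'M[K]_(m, n)) l :
  cvg_entries x l ->
  cvg_entries (fun k => residual A B C D (x k)) (residual A B C D l).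
Proof.
move=> xl; have cst := cvg_entries_cst.
apply: cvg_entriesD (cst _ _ B); apply: cvg_entriesB; last exact: cvg_entriesM.
apply: cvg_entriesB; last exact: cvg_entriesM.
by apply: cvg_entriesM => //; exact: cvg_entriesM.
Qed.

Lemma cvg_entries_sylvester m n (M1 : nat -> 'M[K]_m) (M2 : nat -> 'M[K]_n)
    (x : nat -> 'M[K]_(m, n)) l1 l2 l :
  cvg_entries M1 l1 -> cvg_entries M2 l2 -> cvg_entries x l ->
  cvg_entries (fun k => sylvester (M1 k) (M2 k) (x k)) (sylvester l1 l2 l).
Proof. by move=> *; apply: cvg_entriesD; apply: cvg_entriesM. Qed.

End CvgEntries.

Arguments cvg_entries_cst {K m n} M.
Arguments cvg_entries_residual {K m n} A B C D {x l}.

Lemma mx_le_cvg (R : realType) (m n : nat) (x y : nat -> 'M[R]_(m, n)) l t :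
  cvg_entries x l -> cvg_entries y t -> (forall k, x k <=m y k) -> l <=m t.
Proof.
move=> xl yt xy i j; apply: (ler_cvg_to (xl i j) (yt i j)).
by apply: nearW => k; exact: xy.
Qed.

Lemma mx_norm_ler (K : numFieldType) (m n : nat) (M : 'M[K]_(m, n)) (e : K) :
  0 <= e -> (forall i j, `|M i j| <= e) -> `|M| <= e.
Proof.
move=> e0 Me; have [->//|M0] := eqVneq `|M| 0.
by have [[i j] normM] := mx_norm_neq0 M0; rewrite [leLHS]normM.
Qed.

Lemma mx_entry_norm (K : numFieldType) (m n : nat) (M : 'M[K]_(m, n)) i j :
  `|M i j| <= `|M|.
Proof.
rewrite -[`|M|]/(mx_norm M) mx_normE -[leLHS]nngE num_le.
exact: (le_bigmax _ (fun p : 'I_m * 'I_n => `|M p.1 p.2|%:nng) (i, j)).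
Qed.

Section MajorantLimit.
Context (R : realType).

(** Both [s] and [f + s] are nondecreasing and bounded above, which replaces
    an appeal to completeness by monotone convergence. *)
Lemma is_cvg_majorant (f s : nat -> R) (V : R) :
  (forall k, `|f k.+1 - f k| <= s k.+1 - s k) -> (forall k, s k <= V) ->
  cvgn f /\ cvgn s.
Proof.
move=> fs sV.
have s_cvg : cvgn s.
  apply: nondecreasing_is_cvgn; last by exists V => _ [k _ <-].
  apply/nondecreasing_seqP => k; rewrite -subr_ge0; exact: le_trans (fs k).
split=> //.
have -> : f = (f \+ s) \- s by apply/funext => k /=; rewrite addrK.
apply: is_cvgB => //.
apply: nondecreasing_is_cvgn.
  apply/nondecreasing_seqP => k /=.
  have := fs k; rewrite ler_norml => /andP[+ _]; lra.
have fle k : f k <= f 0 - s 0 + s k.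
  elim: k => [|k IH]; first by rewrite subrK.
  have := fs k; rewrite ler_norml => /andP[_]; lra.
exists (f 0 - s 0 + V + V) => _ [k _ <-] /=.
have := fle k; have := sV k; lra.
Qed.

Lemma majorant_tail (z : nat -> R[i]) (s : nat -> R) :
  (forall k, normc (z k.+1 - z k) <= s k.+1 - s k) ->
  forall k p, (k <= p)%N -> normc (z k - z p) <= s p - s k.
Proof.
move=> zs k; elim=> [|p IH]; first by rewrite leqn0 => /eqP ->; rewrite !subrr Normc.normc0.
rewrite leq_eqVlt => /predU1P[->|]; first by rewrite !subrr Normc.normc0.
rewrite ltnS => /IH kp.
have -> : z k - z p.+1 = (z k - z p) - (z p.+1 - z p) by ring.
by apply: le_trans (normc_triangle _ _) _; rewrite normc_opp; have := zs p; lra.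
Qed.

(** Real and imaginary parts inherit the majorant, so they converge; the
    error estimate is the limit of [majorant_tail]. *)
Lemma majorant_limit (z : nat -> R[i]) (s : nat -> R) (V : R) :
  (forall k, normc (z k.+1 - z k) <= s k.+1 - s k) -> (forall k, s k <= V) ->
  exists l : R[i] * R, s @ \oo --> l.2 /\
    forall k, normc (z k - l.1) <= l.2 - s k.
Proof.
move=> zs sV.
have [reC sC] : cvgn (fun k => complex.Re (z k)) /\ cvgn s.
  apply: (is_cvg_majorant _ sV) => k; rewrite -raddfB /=.
  exact: le_trans (Re_le_normc _) (zs k).
have [imC _] : cvgn (fun k => complex.Im (z k)) /\ cvgn s.
  apply: (is_cvg_majorant _ sV) => k; rewrite -raddfB /=.
  exact: le_trans (Im_le_normc _) (zs k).
pose l : R[i] := (limn (fun k => complex.Re (z k)) +i* limn (fun k => complex.Im (z k)))%C.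
exists (l, limn s); split=> //= k.
have s_le p : s p <= limn s.
  apply: nondecreasing_cvgn_le => //; apply/nondecreasing_seqP => q.
  by rewrite -subr_ge0; apply: le_trans (normc_ge0 _) (zs q).
apply/ler_addgt0Pr => e e0.
have e2 : 0 < e / 2 by rewrite divr_gt0.
move/cvgrPdist_le : reC => /(_ _ e2) reE.
move/cvgrPdist_le : imC => /(_ _ e2) imE.
near \oo => p.
have kp : (k <= p)%N by near: p; exact: nbhs_infty_ge.
have Rp : `|complex.Re (z p - l)| <= e / 2.
  by rewrite raddfB /= distrC; near: p.
have Ip : `|complex.Im (z p - l)| <= e / 2.
  by rewrite raddfB /= distrC; near: p.
have zl : normc (z p - l) <= e / 2 + e / 2.
  rewrite [z p - l]complexE; apply: le_trans (normc_triangle _ _) _.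
  rewrite Normc.normcM; apply: lerD.
    by rewrite /= expr0n addr0 sqrtr_sqr.
  by rewrite /= expr0n expr1n add0r addr0 sqrtr1 mul1r sqrtr_sqr.
have -> : z k - l = (z k - z p) + (z p - l) by ring.
apply: le_trans (normc_triangle _ _) _.
have := majorant_tail zs kp; have := s_le p; lra.
Unshelve. all: by end_near.
Qed.

Lemma majorant_mx_limit (m n : nat) (x : nat -> 'M[R[i]]_(m, n))
    (s : nat -> 'M[R]_(m, n)) (V : 'M[R]_(m, n)) :
  (forall k, mxabs (x k.+1 - x k) <=m s k.+1 - s k) -> (forall k, s k <=m V) ->
  exists l t, cvg_entries s t /\ forall k, mxabs (x k - l) <=m t - s k.
Proof.
move=> xs sV.
have /choice[f fP] (p : 'I_m * 'I_n) : exists l : R[i] * R,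
    (fun k => s k p.1 p.2) @ \oo --> l.2 /\
    forall k, normc (x k p.1 p.2 - l.1) <= l.2 - s k p.1 p.2.
  apply: (@majorant_limit _ _ (V p.1 p.2)) => k; last exact: sV.
  by have := xs k p.1 p.2; rewrite !mxE.
exists (\matrix_(i, j) (f (i, j)).1), (\matrix_(i, j) (f (i, j)).2); split.
  by move=> i j; rewrite mxE; have [] := fP (i, j).
by move=> k i j; rewrite !mxE; have [_] := fP (i, j).
Qed.

Lemma cvg_entries_majorant (m n : nat) (x : nat -> 'M[R[i]]_(m, n))
    (s : nat -> 'M[R]_(m, n)) l t :
  cvg_entries s t -> (forall k, mxabs (x k - l) <=m t - s k) ->
  cvg_entries x l.
Proof.
move=> st xl i j; apply/cvgrPdist_lt => e e0.
have re0 : 0 < complex.Re e by move: e0; rewrite ltcE => /andP[].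
have eE : e = (complex.Re e)%:C%C by rewrite RRe_real // gtr0_real.
move/cvgrPdist_lt : (st i j) => /(_ _ re0); apply: filterS => k tk.
suff : normc (x k i j - l i j) < complex.Re e by rewrite -ltcR -eE distrC.
apply: le_lt_trans tk.
have := xl k i j; rewrite !mxE => /le_trans; apply; exact: ler_norm.
Qed.

Lemma cvg_entries_cvg (K : numFieldType) (m n : nat) (x : nat -> 'M[K]_(m, n)) l :
  cvg_entries x l -> x @ \oo --> l.
Proof.
move=> xl; apply/cvgrPdist_le => e e0.
have near_all : \forall k \near \oo, forall p : 'I_m * 'I_n, `|(l - x k) p.1 p.2| <= e.
  apply: filter_forall => p; move/cvgrPdist_le : (xl p.1 p.2) => /(_ _ e0).
  by apply: filterS => k; mx_entries.
apply: filterS near_all => k xk.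
by apply: mx_norm_ler => [|i j]; [exact: ltW|exact: (xk (i, j))].
Qed.

End MajorantLimit.

(** * Quadratic convergence *)

(** With weights [x, y] for [N1, N2], the matrix [x y] is mapped to a positive
    matrix [P], so a multiple of [x y] majorizes every solution whose
    right-hand side is bounded entrywise. *)
Lemma sylvester_uniform_bound (R : realType) (w : R) (m n : nat)
    (N1 : 'M[R]_m) (N2 : 'M[R]_n) :
  0 <= w <= 1 -> nonsingular_M_matrix N1 -> nonsingular_M_matrix N2 ->
  exists2 K : R, 0 <= K & forall (M1 : 'M[R[i]]_m) (M2 : 'M[R[i]]_n)
      (Y : 'M[R[i]]_(m, n)) (e : R),
    N1 <=m omega_comparison w M1 -> N2 <=m omega_comparison w M2 -> 0 <= e ->
    (forall i j, normc (sylvester M1 M2 Y i j) <= e) ->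
    forall i j, normc (Y i j) <= K * e.
Proof.
move=> w01 MN1 MN2.
have [y [y0 yN]] := nonsingular_M_matrix_row MN2.
have [_ [x [x0 Nx]]] := proj1 (nonsingular_M_matrixP _) MN1.
pose P := sylvester N1 N2 (x *m y).
have P0 i j : 0 < P i j.
  rewrite /P /sylvester mulmxA -[x *m y *m N2]mulmxA addmxE !outermxE.
  have := x0 i 0; have := y0 0 j; have := Nx i 0; have := yN 0 j.
  by rewrite !zeromxE => *; rewrite addr_gt0 // mulr_gt0.
have xy0 i j : 0 <= (x *m y) i j.
  by have := mx_ge0M (mx_lt_le x0) (mx_lt_le y0) i j; rewrite zeromxE.
pose q := \sum_(p : 'I_m * 'I_n) (P p.1 p.2)^-1.
have q0 : 0 <= q by apply: sumr_ge0 => p _; rewrite invr_ge0 ltW.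
have qP i j : 1 <= q * P i j.
  rewrite -ler_pdivrMr // div1r /q (bigD1 (i, j)) //= lerDl.
  by apply: sumr_ge0 => p _; rewrite invr_ge0 ltW.
pose r := \sum_(p : 'I_m * 'I_n) (x *m y) p.1 p.2.
have r0 : 0 <= r by apply: sumr_ge0 => p _; exact: xy0.
exists (r * q); first exact: mulr_ge0.
move=> M1 M2 Y e le1 le2 e0 LY i j.
have YZ : mxabs Y <=m (e * q) *: (x *m y).
  apply: (sylvester_majorant w01 MN1 MN2 le1 le2) => k l.
  have -> : sylvester N1 N2 ((e * q) *: (x *m y)) = (e * q) *: P.
    by rewrite /P /sylvester -scalemxAr -scalemxAl scalerDr.
  rewrite scalemxE mxE; apply: le_trans (LY k l) _.
  by rewrite -mulrA ler_peMr.
have := YZ i j; rewrite mxE scalemxE => /le_trans; apply.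
rewrite mulrC -mulrA [q * e]mulrC ler_wpM2r //; first exact: mulr_ge0.
rewrite /r (bigD1 (i, j)) //= lerDl.
by apply: sumr_ge0 => p _; exact: xy0.
Qed.

Lemma normc_mulmx3_le (R : realType) (m n p q : nat) (X : 'M[R[i]]_(m, n))
    (C : 'M[R[i]]_(n, p)) (Y : 'M[R[i]]_(p, q)) (e : R) :
  0 <= e -> (forall i j, normc (X i j) <= e) -> (forall i j, normc (Y i j) <= e) ->
  forall i j, normc ((X *m C *m Y) i j) <=
    (\sum_k \sum_l normc (C l k)) * e ^+ 2.
Proof.
move=> e0 Xe Ye i j; rewrite mxE; apply: le_trans (normc_sum _ _ _) _.
rewrite mulr_suml; apply: ler_sum => k _; rewrite Normc.normcM expr2 mulrA.
apply: ler_pM => //; [exact: normc_ge0|exact: normc_ge0|].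
rewrite mxE mulr_suml; apply: le_trans (normc_sum _ _ _) _.
apply: ler_sum => l _; rewrite Normc.normcM mulrC.
by apply: ler_wpM2l => //; exact: normc_ge0.
Qed.

(** Newton's equation cancels the terms of order zero and one in the expansion
    of the residual of [Phi] at [X]; only the quadratic term is left. *)
Lemma newton_error (R : realType) (m n : nat) (A : 'M[R[i]]_m)
    (B : 'M[R[i]]_(m, n)) (C : 'M[R[i]]_(n, m)) (D : 'M[R[i]]_n)
    (Phi X Y : 'M[R[i]]_(m, n)) :
  residual A B C D Phi = 0 -> newton_step A B C D X Y ->
  sylvester (A - X *m C) (D - C *m X) (Y - Phi) = - ((X - Phi) *m C *m (X - Phi)).
Proof.
move=> resPhi /newton_stepE XY.
have := residualD A B C D X (Phi - X); rewrite addrC subrK resPhi => taylor.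
have -> : Y - Phi = (Y - X) - (Phi - X) by rewrite opprB addrA subrK.
rewrite sylvesterB XY -[X - Phi]opprB mulNmx mulmxN mulNmx opprK.
by apply/eqP; rewrite -addr_eq0 -taylor.
Qed.

(** * From the comparison matrix to the majorant equation *)

Lemma omega_comparison_block (R : realType) (w : R) (n m : nat)
    (A : 'M[R[i]]_m) (B : 'M[R[i]]_(m, n)) (C : 'M[R[i]]_(n, m)) (D : 'M[R[i]]_n) :
  omega_comparison w (block_mx D (- C) (- B) A) =
  block_mx (omega_comparison w D) (- mxabs C) (- mxabs B) (omega_comparison w A).
Proof.
apply/matrixP => i j; rewrite [LHS]mxE.
case: (split_ordP i) => i' ->; case: (split_ordP j) => j' ->.
- by rewrite !block_mxEul mxE (inj_eq (@lshift_inj _ _)).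
- by rewrite !block_mxEur eq_lrshift !mxE normc_opp.
- by rewrite !block_mxEdl eq_rlshift !mxE normc_opp.
- by rewrite !block_mxEdr mxE (inj_eq (@rshift_inj _ _)).
Qed.

Lemma class_H_dominant (R : realType) (m n : nat) (w : R)
    (A : 'M[R[i]]_m) (B : 'M[R[i]]_(m, n)) (C : 'M[R[i]]_(n, m)) (D : 'M[R[i]]_n) :
  class_H A B C D w ->
  exists u v, dominant_data (omega_comparison w A) (mxabs B) (mxabs C)
    (omega_comparison w D) u v.
Proof.
rewrite /class_H omega_comparison_block => /nonsingular_M_matrixP[_ [x [x0 Qx]]].
move: x0 Qx; rewrite -[x]vsubmxK mul_block_col => x0 Qx.
exists (usubmx x), (dsubmx x); split; split; try exact: Z_matrix_omega_comparison;
  try exact: mxabs_ge0.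
- by move=> i j; have := x0 (lshift m i) j; rewrite !zeromxE col_mxEu.
- by move=> i j; have := x0 (rshift n i) j; rewrite !zeromxE col_mxEd.
- move=> i j; have := Qx (rshift n i) j.
  by rewrite zeromxE col_mxEd mulNmx addrC addmxE oppmxE subr_gt0.
- move=> i j; have := Qx (lshift m i) j.
  by rewrite zeromxE col_mxEu mulNmx addmxE oppmxE subr_gt0.
Qed.

Lemma subsolution_le (R : realType) (m n : nat) (a : 'M[R]_m) b c (d : 'M[R]_n)
    (u : 'cV[R]_n) (v : 'cV[R]_m) (S : 'M[R]_(m, n)) :
  0 <m u -> subsolution a b c d u v S -> S <=m \matrix_(i, j) (v i 0 / u j 0).
Proof.
move=> u0 [S0 Su _] i j; rewrite mxE.
have u_gt0 k : 0 < u k 0 by have := u0 k 0; rewrite zeromxE.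
rewrite ler_pdivlMr //; apply: le_trans (Su i 0).
rewrite mxE (bigD1 j) //= lerDl; apply: sumr_ge0 => k _.
by apply: mulr_ge0; [have := S0 i k; rewrite zeromxE|exact: ltW].
Qed.

Theorem theorem4p1 (R : realType) (m n : nat) (w : R)
    (A : 'M[R[i]]_m) (B : 'M[R[i]]_(m, n))
    (C : 'M[R[i]]_(n, m)) (D : 'M[R[i]]_n)
    (hw : 0 <= w <= 1) (hQ : class_H A B C D w) :
  exists Phi : 'M[R[i]]_(m, n), extremal_solution A B C D w Phi /\
    exists Phi_ : nat -> 'M[R[i]]_(m, n),
      newton_sequence A B C D Phi_ /\ converges_quadratically Phi_ Phi.
Proof.
have [u [v dom]] := class_H_dominant hQ.
have [_ [u0 _ _ _]] := dom.
set a := omega_comparison w A in dom; set b := mxabs B in dom.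
set c := mxabs C in dom; set d := omega_comparison w D in dom.
pose x := newton_iter A B C D; pose s := majorant_iter w A B C D.
have maj k : majorized w A B C D u v (x k) (s k) by exact: majorized_iter.
have subs k : subsolution a b c d u v (s k) by have [] := maj k.
have [Phi [S [sS xS]]] := majorant_mx_limit (newton_iter_increment hw dom)
  (fun k => subsolution_le u0 (subs k)).
have xPhi : cvg_entries x Phi by exact: cvg_entries_majorant sS xS.
have sS_le k : s k <=m S.
  apply/mx_subr_ge0; apply: mx_le_trans (xS k); exact: mxabs_ge0.
have xs k : mxabs (x k) <=m S by have [_ xk _] := maj k; exact: mx_le_trans xk (sS_le k).
have PhiS : mxabs Phi <=m S.
  have -> : Phi = x 0%N + - (x 0%N - Phi) by rewrite opprB addrC subrK.
  apply: mx_le_trans (mxabsD _ _) _; rewrite mxabsN.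
  have -> : S = s 0%N + (S - s 0%N) by rewrite addrC subrK.
  by apply: mx_leD (xS _); have [] := maj 0%N.
(* The conditions defining a subsolution are closed. *)
have subS : subsolution a b c d u v S.
  split.
  - by apply: mx_le_trans (sS_le 0%N); have [] := subs 0%N.
  - have suv k : s k *m u <=m v by have [] := subs k.
    exact: mx_le_cvg (cvg_entriesM sS (cvg_entries_cst u)) (cvg_entries_cst v) suv.
  - have res_ge0 k : 0 <=m residual a b c d (s k) by have [] := subs k.
    exact: mx_le_cvg (cvg_entries_cst 0) (cvg_entries_residual a b c d sS) res_ge0.
have step k : unique (newton_step A B C D (x k)) (x k.+1).
  exact: (newton_unique hw dom subS (xs k)).
(* Newton's equation equates the residual with the image of an increment,
   and the increments tend to zero. *)
have resPhi : residual A B C D Phi = 0.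
  apply: (cvg_entries_unique (cvg_entries_residual A B C D xPhi)).
  have -> : (fun k => residual A B C D (x k)) = (fun k =>
      sylvester (A - x k *m C) (D - C *m x k) (x k.+1 - x k)).
    by apply/funext => k; apply/esym/newton_stepE; have [] := step k.
  have <- : sylvester (A - Phi *m C) (D - C *m Phi) (Phi - Phi) = 0.
    by rewrite subrr sylvester0.
  apply: cvg_entries_sylvester.
  - exact: cvg_entriesB (cvg_entries_cst A) (cvg_entriesM xPhi (cvg_entries_cst C)).
  - exact: cvg_entriesB (cvg_entries_cst D) (cvg_entriesM (cvg_entries_cst C) xPhi).
  - exact: cvg_entriesB (cvg_entries_shift xPhi) xPhi.
have ML := subsolution_left dom subS; have MR := subsolution_right dom subS.
exists Phi; split.
  split=> [|Psi [resPsi specPsi]].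
    split=> // mu; exact: (M_matrix_eigenvalue hw MR (majorant_right C D hw PhiS)).
  apply/esym/eqP; rewrite -subr_eq0; apply/eqP.
  apply: (sylvester_spectrum_eq0 hw ML (majorant_left A C hw PhiS) specPsi).
  have {}resPsi : residual A B C D Psi = 0 := resPsi.
  by rewrite (residualB A B C D) resPhi resPsi subrr.
exists x; split; first by split.
split; first exact: cvg_entries_cvg.
have [K K0 bound] := sylvester_uniform_bound hw ML MR.
pose g := \sum_k \sum_l normc (C l k).
have g0 : 0 <= g by apply: sumr_ge0 => k _; apply: sumr_ge0 => l _; exact: normc_ge0.
exists (K * g)%:C%C; first by rewrite lecR mulr_ge0.
(* The norm of a complex matrix is itself a complex number; the bounds are
   real, so they are applied to its real part. *)
apply: nearW => k; set e := `|x k - Phi|.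
have e0 : 0 <= e by exact: normr_ge0.
have eE : e = (complex.Re e)%:C%C by rewrite RRe_real // ger0_real.
have re0 : 0 <= complex.Re e by rewrite -lecR -eE.
have xe i j : normc ((x k - Phi) i j) <= complex.Re e.
  by rewrite -lecR -eE; exact: mx_entry_norm.
have ce0 : 0 <= g * complex.Re e ^+ 2 by rewrite mulr_ge0 // exprn_ge0.
rewrite eE -rmorphXn -rmorphM /= -mulrA.
apply: mx_norm_ler; first by rewrite lecR mulr_ge0.
move=> i j; suff : normc ((x k.+1 - Phi) i j) <= K * (g * complex.Re e ^+ 2).
  by rewrite -lecR.
apply: (bound _ _ _ _ (majorant_left A C hw (xs k)) (majorant_right C D hw (xs k)) ce0).
move=> p q; rewrite (newton_error resPhi (proj1 (step k))) oppmxE normc_opp.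
exact: normc_mulmx3_le.
Qed.
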